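(* Let $t\geq 1$ and $c\ge 1$ be integers and let $n_1\geq n_2\geq\cdots\geq n_c$ be positive integers. Then $$R(S_{t},n_1K_2,n_2K_2,\ldots,n_cK_2)=\max\{t,n_1\}+\sum_{i=1}^{c}(n_i-1)+1.$$
   Context: All graphs are finite, simple and undirected. $S_n$ denotes the star with $n$ edges (that is, $K_{1,n}$), and $nK_2$ denotes a matching of size $n$, i.e. $n$ pairwise disjoint edges. For graphs $G_1,\ldots,G_m$, the Ramsey number $R(G_1,\ldots,G_m)$ is the smallest positive integer $n$ such that whenever the edges of the complete graph $K_n$ are partitioned into $m$ disjoint (possibly empty) color classes giving graphs $H_1,\ldots,H_m$, at least one $H_i$ contains a subgraph isomorphic to $G_i$. *)

(* Defs.v *)
(* Finite simple graphs and multicolour Ramsey numbers, over MathComp. *)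
From mathcomp Require Import all_boot.

Set Implicit Arguments.
Unset Strict Implicit.
Unset Printing Implicit Defensive.

Record graph_on (V : finType) := GraphOn {
  adj :> rel V;
  adj_sym : symmetric adj;
  adj_irr : irreflexive adj }.

Record graph := Graph {
  vertex : finType;
  graph_edges :> graph_on vertex }.

Lemma complete_sym (V : finType) : symmetric (fun x y : V => x != y).
Proof. by move=> x y; rewrite eq_sym. Qed.

Lemma complete_irr (V : finType) : irreflexive (fun x y : V => x != y).
Proof. by move=> x; rewrite eqxx. Qed.

Definition complete (N : nat) : graph_on 'I_N :=
  GraphOn (@complete_sym 'I_N) (@complete_irr 'I_N).

(* K_{1,t}: the centre is ord0, the t other vertices are the leaves. *)
Definition star_adj (t : nat) : rel 'I_t.+1 :=
  fun x y => (x == ord0) != (y == ord0).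

Lemma star_sym (t : nat) : symmetric (@star_adj t).
Proof. by move=> x y; rewrite /star_adj eq_sym. Qed.

Lemma star_irr (t : nat) : irreflexive (@star_adj t).
Proof. by move=> x; rewrite /star_adj eqxx. Qed.

Definition star (t : nat) : graph := Graph (GraphOn (@star_sym t) (@star_irr t)).

(* n K_2: the i-th edge joins (i, false) and (i, true). *)
Definition matching_adj (n : nat) : rel ('I_n * bool) :=
  fun x y => (x.1 == y.1) && (x.2 != y.2).

Lemma matching_sym (n : nat) : symmetric (@matching_adj n).
Proof. by move=> x y; rewrite /matching_adj eq_sym (eq_sym x.2). Qed.

Lemma matching_irr (n : nat) : irreflexive (@matching_adj n).
Proof. by move=> x; rewrite /matching_adj !eqxx. Qed.

Definition matching (n : nat) : graph :=
  Graph (GraphOn (@matching_sym n) (@matching_irr n)).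

(* H has a (not necessarily induced) subgraph isomorphic to G: the image of
   an injective map on vertices that preserves edges. *)
Definition contains (V : finType) (H : graph_on V) (G : graph) : Prop :=
  exists f : vertex G -> V,
    injective f /\ forall x y : vertex G, G x y -> H (f x) (f y).

(* Colour classes may be empty. *)
Definition edge_partition (V : finType) (K : graph_on V) (m : nat)
    (H : 'I_m -> graph_on V) : Prop :=
  (forall i x y, H i x y -> K x y) /\
  (forall x y, K x y -> exists! i : 'I_m, H i x y).

Definition arrows (m : nat) (G : 'I_m -> graph) (N : nat) : Prop :=
  forall H : 'I_m -> graph_on 'I_N,
    edge_partition (complete N) H -> exists i : 'I_m, contains (H i) (G i).

(* Relational form of R(G_1, ..., G_m) = N: "N is the smallest positive
   integer such that ..." also asserts that such an integer exists. *)
Definition is_ramsey_number (m : nat) (G : 'I_m -> graph) (N : nat) : Prop :=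
  [/\ 0 < N, arrows G N & forall M : nat, 0 < M -> arrows G M -> N <= M].

(* The family x, f 0, ..., f (m - 1). *)
Definition fcons (T : Type) (m : nat) (x : T) (f : 'I_m -> T) : 'I_m.+1 -> T :=
  fun i => if unlift ord0 i is Some j then f j else x.

(* Main.v *)
Require Import Defs.
From mathcomp Require Import all_boot zify.

Set Implicit Arguments.
Unset Strict Implicit.
Unset Printing Implicit Defensive.

(** The lower bound labels the vertices with colours, label i being used at most
    n_i - 1 times and label 0 at most t times, and gives each edge the larger
    label of its two ends.  Every edge of colour i > 0 then meets one of at most
    n_i - 1 vertices, which excludes n_i disjoint edges, and colour 0 lives on t
    vertices, which excludes S_t.  When t < n_1, label 0 is not used at all and
    label 1 is used 2 n_1 - 1 times: that is too few vertices for n_1 disjoint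
    edges.  Either way max(t, n_1) + sum (n_i - 1) vertices can be labelled.

    For the upper bound, suppose that no colour contains its graph.  The core is
    what a graph without n disjoint edges looks like ([matching_free_structure]).
    As in the Gallai-Edmonds theory, delete a largest set S such that no matching
    of the rest has more than n - 1 - |S| edges.  In the rest, every vertex is
    missed by some maximum matching, and then (Gallai's lemma,
    [inseparable_trans]) being missed by no common maximum matching is an
    equivalence relation.  Its classes contain all remaining edges, and each
    maximum matching misses at most one vertex of a class.  With
    m = n - 1 - |S|, the classes together have at most 2m covered vertices, so at
    most one class B has more than m, say m + e; its vertices have degree at
    most m + e and all others have degree at most m - e.

    Now delete the sets S_i of all colours i > 0, leaving a set W of at least
    max(t, n_1) + sum m_i + 1 vertices.  A vertex of W has fewer than t
    neighbours of colour 0, hence more than sum m_i of the other colours; so the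
    e_i of the classes B_i that contain it have more than half of the total
    weight.  Two such majorities overlap: any two vertices of W lie in a common
    B_i.  Counting ordered pairs gives |W| (|W| - 1) <= sum |B_i| (|B_i| - 1)
    ([pair_cover_bound]).  With k = max(t, n_1) and s = sum m_i, the bounds
    |B_i| <= 2 m_i + 1 <= 2k - 1 give (k + s + 1) (k + s) <= 2 (2k - 1) s, which
    contradicts 4 k s <= (k + s)^2. *)

(** * Matchings as involutions *)

Section Matchings.
Variables (V : finType) (H : graph_on V).
Implicit Types (A P : {set V}) (M N : {ffun V -> V}) (u v w x y : V).

(** A matching is encoded as the involution that exchanges the two ends of each
    edge and fixes the other vertices, so that the alternating paths of two
    matchings are orbits. *)
Definition matching_in A M :=
  [forall x, (M (M x) == x) && ((M x != x) ==> (x \in A) && H x (M x))].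

Definition covered M := [set x | M x != x].

Definition max_matching_in A M :=
  matching_in A M &&
  [forall N, matching_in A N ==> (#|covered N| <= #|covered M|)].

Lemma matching_inP A M :
  reflect (involutive M /\ forall x, M x != x -> x \in A /\ H x (M x))
          (matching_in A M).
Proof.
apply: (iffP forallP) => [h | [invM edM] x].
  split=> [x|x nx]; first by have /andP[/eqP] := h x.
  by have /andP[_ /implyP/(_ nx)/andP] := h x.
by rewrite invM eqxx; apply/implyP => /edM[-> ->].
Qed.

Lemma matching_in_sub A A' M :
  A \subset A' -> matching_in A M -> matching_in A' M.
Proof.
move=> /subsetP sA /matching_inP[invM edM]; apply/matching_inP; split=> // x.
by case/edM=> /sA.
Qed.

Lemma max_matching_inP A M :
  reflect (matching_in A M /\
           forall N, matching_in A N -> #|covered N| <= #|covered M|)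
          (max_matching_in A M).
Proof.
apply: (iffP andP) => -[mM h]; split=> //.
  by move=> N mN; have /implyP := forallP h N; apply.
by apply/forallP=> N; apply/implyP/h.
Qed.

Lemma ex_max_matching A : exists M, max_matching_in A M.
Proof.
have m0 : matching_in A [ffun x => x].
  by apply/matching_inP; split=> x; rewrite !ffunE ?eqxx.
case: (arg_maxnP (fun M => #|covered M|) m0) => M mM maxM.
by exists M; apply/max_matching_inP.
Qed.

(** [T] picks one end of each edge, the first one in the enumeration of [V];
    it serves both to list the edges and to see that [covered M] is even. *)
Lemma matching_endpoints A M : matching_in A M ->
  exists T : {set V},
    [/\ #|covered M| = #|T|.*2, {in T, forall x, M x \notin T}
      & {in T, forall x, M x != x}].
Proof.
case/matching_inP=> invM _.
pose T := [set x | enum_rank x < enum_rank (M x)].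
exists T; split=> [|x|x]; last 2 first.
- by rewrite !inE invM -leqNgt => /ltnW.
- by rewrite inE; apply: contraL => /eqP->; rewrite ltnn.
have injM : injective M := can_inj invM.
have inMT x : (x \in M @: T) = (enum_rank (M x) < enum_rank x).
  by rewrite -{1}[x]invM (mem_imset _ _ injM) inE invM.
have cT : #|M @: T| = #|T| by apply: card_imset.
rewrite -addnn -{2}cT -cardsUI.
rewrite [X in _ = _ + X](_ : _ = 0) ?addn0.
  apply: eq_card => x; rewrite in_setU inMT !inE.
  by rewrite -neq_ltn eq_sym (inj_eq (@ord_inj _)) (inj_eq enum_rank_inj).
apply: eq_card0 => x; rewrite in_setI inMT !inE.
by case: ltngtP.
Qed.

Lemma contains_matching A M n :
  matching_in A M -> n.*2 <= #|covered M| -> contains H (matching n).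
Proof.
move=> mM; have [T [-> MT MTn]] := matching_endpoints mM; rewrite leq_double => nT.
case/matching_inP: mM => invM edM.
pose e (i : 'I_n) : V := enum_val (widen_ord nT i).
have eT i : e i \in T by apply: enum_valP.
have eI : injective e by move=> i j /enum_val_inj/(congr1 val)/= /val_inj.
exists (fun p : 'I_n * bool => if p.2 then M (e p.1) else e p.1); split.
  move=> [i [|]] [j [|]] /= E.
  - by rewrite (eI i j) // (can_inj invM E).
  - by case/negP: (MT _ (eT i)); rewrite E.
  - by case/negP: (MT _ (eT j)); rewrite -E.
  - by rewrite (eI i j).
move=> [i b] [j b'] /=; rewrite /matching_adj /= => /andP[/eqP<-].
have [_ He] := edM _ (MTn _ (eT i)).
by case: b; case: b' => // _; rewrite adj_sym.
Qed.

Lemma contains_star t v :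
  t <= #|[set u | H v u]| -> contains H (star t).
Proof.
set D := [set u | H v u] => tD.
pose e (i : 'I_t) : V := enum_val (widen_ord tD i).
have eD i : H v (e i) by have := enum_valP (widen_ord tD i); rewrite inE.
have eI : injective e by move=> i j /enum_val_inj/(congr1 val)/= /val_inj.
have ve i : v <> e i by move=> E; have := eD i; rewrite -E adj_irr.
exists (fun i : 'I_t.+1 => if unlift ord0 i is Some j then e j else v); split.
  move=> i j; case: unliftP => [i'|] ->; case: unliftP => [j'|] -> //.
  - by move/eI->.
  - by move/esym/ve.
  - by move/ve.
move=> i j; rewrite /= /star_adj.
case: unliftP => [i'|] ->; case: unliftP => [j'|] -> //; rewrite ?eqxx //.
by rewrite adj_sym.
Qed.

Lemma odd_covered A M : matching_in A M -> odd #|covered M| = false.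
Proof. by case/matching_endpoints=> T [-> _ _]; rewrite odd_double. Qed.

(** The symmetric difference of [M] with the alternating paths that form [P]. *)
Definition switch P N M := [ffun x => if x \in P then N x else M x].

Lemma switch_matching A P N M :
  matching_in A N -> matching_in A M ->
  {in P, forall x, M x \in P} -> {in P, forall x, N x \in P} ->
  matching_in A (switch P N M).
Proof.
case/matching_inP=> invN edN /matching_inP[invM edM] PM PN.
apply/matching_inP; split=> x; rewrite !ffunE; have [xP|xP] := boolP (x \in P).
- by rewrite PN // invN.
- by case: ifP => [/PM|_]; rewrite invM // (negbTE xP).
- exact: edN.
- exact: edM.
Qed.

Lemma covered_switch P N M :
  #|covered (switch P N M)| = #|covered N :&: P| + #|covered M :\: P|.
Proof.
rewrite -(cardsID P); congr (_ + _); apply: eq_card => x; rewrite !inE ffunE.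
  by case: (x \in P); rewrite ?andbF.
by case: (x \in P); rewrite ?andbF.
Qed.

Lemma augment_edge A M u v :
  matching_in A M -> H u v -> u \in A -> v \in A -> M u = u -> M v = v ->
  exists2 N, matching_in A N & #|covered M| < #|covered N|.
Proof.
case/matching_inP=> invM edM Huv uA vA Mu Mv.
have nuv : u != v by apply/negP=> /eqP uv; move: Huv; rewrite uv adj_irr.
pose N := [ffun x => if x == u then v else if x == v then u else M x].
have NE x : N x = if x == u then v else if x == v then u else M x by rewrite ffunE.
exists N.
  apply/matching_inP; split=> x; rewrite !NE.
    case: (x =P u) => [->|/eqP xu]; first by rewrite eq_sym (negbTE nuv) eqxx.
    case: (x =P v) => [->|/eqP xv]; first by rewrite eqxx.
    rewrite !(inv_eq invM) Mu Mv (negbTE xu) (negbTE xv).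
    exact: invM.
  case: (x =P u) => [->|/eqP xu] //.
  by case: (x =P v) => [->|/eqP xv]; [rewrite adj_sym | apply: edM].
apply: (@leq_trans #|u |: covered M|); first by rewrite cardsU1 inE Mu eqxx.
apply/subset_leq_card/subsetP=> x; rewrite !inE NE.
case: (x =P u) => [-> _|_ /=]; first by rewrite eq_sym.
by case: (x =P v) => [->|//]; rewrite Mv eqxx.
Qed.

(** * Gallai's lemma *)

(** The component of [v] in the union of two matchings, [v] being missed by
    [N], is a path; its only end missed by [M], if any, is the other one.  In
    terms of involutions: the component is the orbit of [v] under [g = N \o M],
    and [M] maps [g^k v] to [g^(-k-1) v], so that [M] fixes [g^k v] exactly when
    [g^(2k+1) v = v].  The order of [v] being odd then, two such points
    coincide. *)
Lemma alternating_path M N v :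
  involutive M -> involutive N -> N v = v ->
  exists P : {set V},
    [/\ v \in P, {in P, forall x, M x \in P}, {in P, forall x, N x \in P}
      & {in P &, forall u w, M u = u -> M w = w -> u = w}].
Proof.
move=> invM invN Nv.
pose g x := N (M x); pose h x := M (N x).
have gI : injective g by move=> x y /(can_inj invN)/(can_inj invM).
have hg : cancel h g by move=> x; rewrite /g /h invM invN.
have Mg k : M (iter k g v) = iter k.+1 h v.
  elim: k => [|k IH]; first by rewrite /= /h Nv.
  by rewrite [in RHS]iterS -IH.
have Ng k : N (iter k g v) = iter k h v.
  by case: k => [|k] //; rewrite iterS /g invN Mg.
have gh k : iter k g (iter k h v) = v.
  by elim: k => [|k IH] //; rewrite iterSr iterS hg.
pose P := [set x | fconnect g v x].
have hP k : iter k h v \in P.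
  by rewrite inE fconnect_sym // -{2}(gh k) fconnect_iter.
exists P; split; first by rewrite inE connect0.
- by move=> x; rewrite inE => /iter_findex <-; rewrite Mg.
- by move=> x; rewrite inE => /iter_findex <-; rewrite Ng.
have odd_return i : M (iter i g v) = iter i g v -> iter i.*2.+1 g v = v.
  by rewrite Mg -addnn -addSn iterD => <-; apply: gh.
have iter_mul d q : iter d g v = v -> iter (q * d) g v = v.
  by move=> hd; elim: q => [|q IH] //; rewrite mulSn iterD IH.
have main i j : i <= j -> iter i.*2.+1 g v = v -> iter j.*2.+1 g v = v ->
    iter i g v = iter j g v.
  move=> le_ij hi hj; pose d := j - i.
  have h2 : iter d.*2 g v = v.
    by rewrite -{1}hi -iterD -{2}hj; congr (iter _ g v); rewrite /d; lia.
  (* d (2i + 1) = d + i (2d), and both 2i + 1 and 2d fix v *)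
  have hd : iter d g v = v.
    rewrite -{1}(iter_mul _ i h2) -iterD -{2}(iter_mul _ d hi).
    by congr (iter _ g v); lia.
  by rewrite -(subnKC le_ij) iterD hd.
move=> u w; rewrite !inE => /iter_findex <- /iter_findex <-.
move=> /odd_return hi /odd_return hj.
by case/orP: (leq_total (findex g v u) (findex g v w)) => le;
   [|symmetry]; apply: main.
Qed.

Definition inseparable A u v :=
  (u == v) || [forall M, max_matching_in A M ==> (u \in covered M) || (v \in covered M)].

Lemma inseparable_sym A : symmetric (inseparable A).
Proof.
move=> u v; rewrite /inseparable eq_sym; congr (_ || _).
by apply: eq_forallb => M; rewrite orbC.
Qed.

Lemma inseparableP A u v M :
  inseparable A u v -> max_matching_in A M -> M u = u -> M v = v -> u = v.
Proof.
case/orP=> [/eqP //|/forallP/(_ M)/implyP h /h].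
by rewrite !inE => /orP[]/eqP.
Qed.

(** If a maximum matching [M] missed both [u] and [w], it would cover [v], while
    some maximum [N] misses [v].  The alternating path from [v] avoids [u] or
    [w], since it contains at most one vertex missed by [M]; switching [M] along
    it gives a maximum matching that misses [v] and the avoided vertex. *)
Lemma inseparable_trans A :
  {in A, forall v, exists2 N, max_matching_in A N & N v = v} ->
  {in A, forall v u w,
    inseparable A u v -> inseparable A v w -> inseparable A u w}.
Proof.
move=> missable v vA u w uv vw.
case: (u =P v) => [->//|/eqP nuv]; case: (v =P w) => [<-//|/eqP nvw].
rewrite /inseparable; case: eqP => //= /eqP nuw.
apply/forallP=> M; apply/implyP=> maxM; rewrite !inE -negb_and.
apply/negP=> /andP[/eqP Mu /eqP Mw].
have [N maxN Nv] := missable v vA.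
have /max_matching_inP[mM bM] := maxM; have /max_matching_inP[mN bN] := maxN.
have /matching_inP[invM _] := mM; have /matching_inP[invN _] := mN.
have [P [vP PM PN Puniq]] := alternating_path invM invN Nv.
have maxM' : max_matching_in A (switch P N M).
  apply/max_matching_inP; split; first exact: switch_matching.
  (* switching N along P instead cannot enlarge N, so P loses nothing here *)
  move=> L /bM /leq_trans -> //; rewrite covered_switch -(cardsID P) leq_add2r.
  have := bN _ (switch_matching mM mN PN PM).
  by rewrite covered_switch -(cardsID P (covered N)) leq_add2r.
have M'v : switch P N M v = v by rewrite ffunE vP.
have M'E x : x \notin P -> M x = x -> switch P N M x = x.
  by move=> xP; rewrite ffunE (negbTE xP).
have [uP|uP] := boolP (u \in P); last first.
  by case/eqP: nuv; apply: (inseparableP uv maxM' (M'E _ uP Mu) M'v).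
have [wP|wP] := boolP (w \in P); last first.
  by case/eqP: nvw; apply: (inseparableP vw maxM' M'v (M'E _ wP Mw)).
by case/eqP: nuw; apply: Puniq.
Qed.

(** Otherwise the edge could be added to a maximum matching. *)
Lemma adj_inseparable A u v :
  u \in A -> v \in A -> H u v -> inseparable A u v.
Proof.
move=> uA vA Huv; apply/orP; right; apply/forallP=> M; apply/implyP.
case/max_matching_inP=> mM bM; rewrite !inE -negb_and; apply/negP.
case/andP=> /eqP Mu /eqP Mv.
have [N /bM] := augment_edge mM Huv uA vA Mu Mv.
by rewrite ltnNge => ->.
Qed.

(** * The structure of a graph without n disjoint edges *)

(** Take [S] of largest size subject to the first property.  If every maximum
    matching of the complement covered [v], adding [v] to [S] would lower the
    number of covered vertices, hence by at least 2, and keep the property. *)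
Lemma barrier n :
  (forall M, matching_in setT M -> #|covered M| < n.*2) ->
  exists S : {set V},
   [/\ forall M, matching_in (~: S) M -> #|covered M| + #|S|.*2 <= n.-1.*2
     & {in ~: S, forall v, exists2 N, max_matching_in (~: S) N & N v = v}].
Proof.
move=> noM.
pose ok (S : {set V}) :=
  [forall M, matching_in (~: S) M ==> (#|covered M| + #|S|.*2 <= n.-1.*2)].
have ok0 : ok set0.
  apply/forallP=> M; apply/implyP=> mM; rewrite cards0 addn0.
  by have := odd_covered mM; have := noM _ (matching_in_sub (subsetT _) mM); lia.
case: (arg_maxnP (fun S : {set V} => #|S|) ok0) => S okS maxS.
have okSP M : matching_in (~: S) M -> #|covered M| + #|S|.*2 <= n.-1.*2.
  by move/implyP: (forallP okS M); apply.
exists S; split=> // v; rewrite inE => vS.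
have [/existsP[N /andP[maxN /eqP Nv]]|] :=
  boolP [exists N, max_matching_in (~: S) N && (N v == v)]; first by exists N.
rewrite negb_exists => /forallP essential.
suff okvS : ok (v |: S) by have := maxS _ okvS; rewrite cardsU1 vS; lia.
apply/forallP=> M; apply/implyP=> mM; rewrite cardsU1 vS /=.
have sub : ~: (v |: S) \subset ~: S by rewrite setCS subsetUr.
have mM' := matching_in_sub sub mM.
have [N maxN] := ex_max_matching (~: S).
have /max_matching_inP[mN bN] := maxN.
have le := okSP _ mN.
have lt : #|covered M| < #|covered N|.
  rewrite ltnNge; apply/negP=> le'.
  have := essential M; case/andP; split.
    by apply/max_matching_inP; split=> // L /bN/leq_trans; apply.
  case/matching_inP: mM => _ edM.
  by apply/negPn/negP=> /edM[]; rewrite !inE eqxx.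
by have := odd_covered mM; have := odd_covered mN; lia.
Qed.

(** [B] is the class of inseparable vertices that has more than [m] vertices
    covered by a fixed maximum matching, [m + e] of them; a second such class
    would exceed the total [2m].  If there is none, [B] is empty and [e = 0]. *)
Lemma matching_free_structure n :
  (forall M, matching_in setT M -> #|covered M| < n.*2) ->
  exists S B : {set V}, exists e m : nat,
   [/\ m + #|S| = n.-1, e <= m, #|B| <= m + e + 1
     & {in ~: S, forall v,
         if v \in B then #|[set u in ~: S | H v u]| <= m + e
         else #|[set u in ~: S | H v u]| + e <= m}].
Proof.
move=> noM; have [S [okS missable]] := barrier noM.
have [M maxM] := ex_max_matching (~: S).
have /max_matching_inP[mM _] := maxM.
pose C v := [set u in ~: S | inseparable (~: S) v u].
pose p v := #|C v :&: covered M|.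
pose m := n.-1 - #|S|; have bM := okS _ mM.
have trans := inseparable_trans missable.
have CE u v : u \in ~: S -> v \in ~: S -> u \in C v -> C u = C v.
  move=> uS vS; rewrite inE uS /= => vu; apply/setP=> w; rewrite !inE.
  apply: andb_id2l => _; apply/idP/idP => [uw|vw].
    exact: trans _ uS _ _ vu uw.
  by apply: (trans _ vS); first by rewrite inseparable_sym.
have CC v : v \in ~: S -> v \in C v.
  by move=> vS; rewrite inE vS /inseparable eqxx.
(* two vertices of a class missed by M would be separated by M *)
have cardC v : v \in ~: S -> #|C v| <= p v + 1.
  move=> vS; rewrite -(cardsID (covered M)) leq_add2l.
  apply/card_le1_eqP => x y; rewrite !inE !negbK.
  move=> /and3P[/eqP Mx xS vx] /and3P[/eqP My yS vy].
  apply: inseparableP maxM My Mx => //.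
  by apply: (trans _ vS) => //; rewrite inseparable_sym.
have degC v : v \in ~: S -> #|[set u in ~: S | H v u]| <= p v.
  move=> vS; have := cardC v vS; rewrite (cardsD1 v (C v)) CC // add1n addn1 ltnS.
  apply: leq_trans; apply/subset_leq_card/subsetP=> u.
  rewrite !in_setD1 !in_set => /andP[uS Hvu].
  rewrite uS adj_inseparable ?in_setC // -?in_setC // !andbT.
  by case: eqP Hvu => // ->; rewrite adj_irr.
(* distinct classes share the covered vertices *)
have disj u v : u \in ~: S -> v \in ~: S -> u \notin C v -> p u + p v <= m.*2.
  move=> uS vS uv; apply: (@leq_trans #|covered M|); last by rewrite /m; lia.
  rewrite -cardsUI [X in _ + X](_ : _ = 0) ?addn0.
    by apply/subset_leq_card; rewrite -setIUl subsetIr.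
  apply: eq_card0 => w; apply/negbTE/negP; rewrite !inE.
  case/andP=> /andP[/andP[wS uw] _] /andP[/andP[_ vw] _].
  case/negP: uv; rewrite !inE in uS *; rewrite uS /=.
  by apply: (trans w); rewrite ?inE // inseparable_sym.
have [/existsP[v0 /andP[v0S pv0]]|] := boolP [exists v, (v \in ~: S) && (m < p v)].
  have p2 : p v0 <= m.*2.
    apply: (@leq_trans #|covered M|); last by rewrite /m; lia.
    by apply/subset_leq_card; rewrite subsetIr.
  exists S, (C v0), (p v0 - m), m.
  have em : m + (p v0 - m) = p v0 by rewrite subnKC // ltnW.
  rewrite em; split.
  - by rewrite /m; lia.
  - by rewrite leq_subLR addnn.
  - exact: cardC.
  move=> v vS; case: ifPn => vC.
    by rewrite (leq_trans (degC v vS)) // /p (CE v v0).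
  by have := disj v v0 vS v0S vC; have := degC v vS; lia.
rewrite negb_exists => /forallP small.
exists S, set0, 0, m; split=> //; rewrite ?cards0 //.
- by rewrite /m; lia.
move=> v vS; rewrite inE addn0 (leq_trans (degC v vS)) //.
by have := small v; rewrite vS -leqNgt.
Qed.

End Matchings.

(** * The upper bound *)

Lemma card_cover_le (I T : finType) (A : {set T}) (F : I -> {set T}) :
  (forall x, x \in A -> exists i, x \in F i) -> #|A| <= \sum_i #|F i|.
Proof.
move=> cov; apply: (@leq_trans #|\bigcup_i F i|).
  by apply/subset_leq_card/subsetP=> x /cov[i xi]; apply/bigcupP; exists i.
elim/big_ind2: _ => [|m X n Y Xm Yn|//]; first by rewrite cards0.
by rewrite (leq_trans (leq_card_setU X Y)) ?leq_add.
Qed.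

(** A vertex of [W] has its other [#|W| - 1] vertices spread over the sets
    [B i] that contain it; sum this over [W]. *)
Lemma pair_cover_bound (I T : finType) (W : {set T}) (B : I -> {set T}) :
  {in W &, forall u v, exists i, (u \in B i) && (v \in B i)} ->
  #|W| * #|W|.-1 <= \sum_i #|B i| * #|B i|.-1.
Proof.
move=> cov.
have deg v : v \in W -> #|W|.-1 <= \sum_(i | v \in B i) #|B i|.-1.
  move=> vW; rewrite (cardsD1 v W) vW /= big_mkcond /=.
  pose F i := if v \in B i then B i :\ v else set0.
  rewrite (eq_bigr (fun i => #|F i|)) => [|i _]; last first.
    by rewrite /F; case: ifP => vB; rewrite ?cards0 // (cardsD1 v (B i)) vB.
  apply: card_cover_le => u; rewrite !inE => /andP[uv uW].
  by have [i /andP[vB uB]] := cov _ _ vW uW; exists i; rewrite /F vB !inE uv.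
apply: (@leq_trans (\sum_(v in W) \sum_(i | v \in B i) #|B i|.-1)).
  by rewrite -sum_nat_const; apply: leq_sum.
rewrite (exchange_big_dep predT) //=; apply: leq_sum => i _.
rewrite sum_nat_const leq_mul2r; apply/orP; right.
by apply/subset_leq_card/subsetP=> v; rewrite unfold_in => /andP[].
Qed.

(** The parameter [k] stands for the maximum of [t] and all the [n i]. *)
Lemma star_or_matching (V : finType) (t c k : nat) (n : 'I_c -> nat)
    (H : 'I_c.+1 -> graph_on V) :
  0 < t -> t <= k -> (forall i, n i <= k) ->
  k + \sum_(i < c) (n i - 1) + 1 <= #|V| ->
  (forall x y, x != y -> exists i, H i x y) ->
  contains (H ord0) (star t) \/
  exists i : 'I_c, contains (H (lift ord0 i)) (matching (n i)).
Proof.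
move=> t_gt0 t_le n_le cardV coloured; have k_gt0 := leq_trans t_gt0 t_le.
have [/existsP[v /contains_star]|/existsPn noStar] :=
  boolP [exists v, t <= #|[set u | H ord0 v u]|]; first by left.
have [/existsP[i /existsP[M /andP[mM nM]]]|/existsPn noMatching] :=
  boolP [exists i : 'I_c, exists M,
    matching_in (H (lift ord0 i)) setT M && ((n i).*2 <= #|covered M|)].
  by right; exists i; apply: contains_matching mM nM.
have few (i : 'I_c) M : matching_in (H (lift ord0 i)) setT M -> #|covered M| < (n i).*2.
  by move=> mM; have /existsPn/(_ M) := noMatching i; rewrite mM -ltnNge.
have structure (i : 'I_c) := matching_free_structure (few i).
have [S] := fin_all_exists structure.
case/fin_all_exists=> B /fin_all_exists[e /fin_all_exists[m HS]].
have Hm i : m i + #|S i| = n i - 1 by have [-> _ _ _] := HS i; lia.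
pose W := [set v | [forall i, v \notin S i]].
pose d i v := #|[set u in ~: S i | H (lift ord0 i) v u]|.
have cardW : k + \sum_i m i + 1 <= #|W|.
  have cW : #|~: W| <= \sum_i #|S i|.
    apply: card_cover_le => v; rewrite !inE negb_forall.
    by case/existsP=> i; rewrite negbK; exists i.
  have := cardsC W; have : \sum_i (n i - 1) = \sum_i m i + \sum_i #|S i|.
    by rewrite -big_split; apply: eq_bigr => i _ /=; rewrite Hm.
  by move=> splitSum total; move: cardV cW; rewrite splitSum -total; clear; lia.
(* the edges at v inside W, less the at most t - 1 of colour 0 *)
have sum_d v : v \in W -> \sum_i m i < \sum_i d i v.
  move=> vW; have deg0 : #|[set u | H ord0 v u]| < t.
    by rewrite ltnNge.
  pose F i := if unlift ord0 i is Some j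
              then [set u in ~: S j | H (lift ord0 j) v u] else [set u | H ord0 v u].
  have : #|W :\ v| <= \sum_i #|F i|.
    apply: card_cover_le => u; rewrite !inE eq_sym => /andP[vu /forallP uW].
    have [i Hi] := coloured _ _ vu; exists i; rewrite /F.
    by case: unliftP Hi => [j|] -> Hi; rewrite !inE Hi ?uW.
  rewrite big_ord_recl /F unlift_none.
  rewrite [X in _ + X](eq_bigr (fun i => d i v)) => [|i _]; last by rewrite liftK.
  by move: cardW; rewrite (cardsD1 v W) vW; lia.
(* the classes through v outweigh the others *)
have heavy v : v \in W ->
    \sum_(i | v \notin B i) e i < \sum_(i | v \in B i) e i.
  move=> vW; have := sum_d v vW.
  suff : \sum_i d i v + \sum_(i | v \notin B i) e i
         <= \sum_i m i + \sum_(i | v \in B i) e i by lia.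
  rewrite ![\sum_(i | _ \in _) _]big_mkcond [\sum_(i | _ \notin _) _]big_mkcond /=.
  rewrite -!big_split; apply: leq_sum => i _ /=.
  have [_ _ _ /(_ v)] := HS i; rewrite inE; move: vW; rewrite inE => /forallP->.
  by move=> /(_ isT); case: ifP; rewrite addn0.
(* otherwise the two strict majorities would be disjoint *)
have pairs : {in W &, forall u v, exists i, (u \in B i) && (v \in B i)}.
  move=> u v /heavy hu /heavy hv; apply/existsP; apply: contraT => /existsPn disj.
  have sub x y : (forall i, ~~ ((x \in B i) && (y \in B i))) ->
      \sum_(i | x \in B i) e i <= \sum_(i | y \notin B i) e i.
    move=> dxy; rewrite [X in X <= _]big_mkcond [X in _ <= X]big_mkcond /=.
    apply: leq_sum => i _; have := dxy i.
    by case: (x \in B i) => //= ->.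
  have := sub _ _ disj; have := sub v u; move: hu hv.
  have : forall i, ~~ ((v \in B i) && (u \in B i)) by move=> i; rewrite andbC.
  by move=> h ? ? /(_ h); lia.
have := pair_cover_bound pairs.
have : \sum_i #|B i| * #|B i|.-1 <= (k.*2.-1).*2 * \sum_i m i.
  rewrite big_distrr; apply: leq_sum => i _ /=.
  have [_ em Bm _] := HS i; have := Hm i; have := n_le i.
  move=> nk mS.
  have b1 : #|B i| <= k.*2.-1 by lia.
  have b2 : #|B i|.-1 <= (m i).*2 by lia.
  by apply: leq_trans (leq_mul b1 b2) _; lia.
move: cardW; set w := #|W|; set s := \sum_i m i => h1 h2 h3.
have : (k + s + 1) * (k + s) <= k.*2.-1.*2 * s.
  apply: leq_trans (leq_trans h3 h2); apply: leq_mul => //; lia.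
have [agm _] := nat_AGM2 k s; rewrite expnS expn1 in agm.
clear -k_gt0 agm; case: k k_gt0 agm => // k' _; rewrite doubleS /=.
lia.
Qed.

(** * The lower bound *)

(** Inject [T] into a set of slots, [a i] of them for each label [i]. *)
Lemma capacity_labelling (I T : finType) (a : I -> nat) :
  #|T| <= \sum_i a i ->
  exists l : T -> I, forall i, #|[set x | l x == i]| <= a i.
Proof.
move=> le.
have card_slots : #|{: {i : I & 'I_(a i)}}| = \sum_i a i.
  rewrite card_tagged sumnE big_map big_enum.
  by apply: eq_bigr => i _; rewrite card_ord.
have le' : #|T| <= #|{: {i : I & 'I_(a i)}}| by rewrite card_slots.
pose g x : {i : I & 'I_(a i)} := enum_val (widen_ord le' (enum_rank x)).
have gI : injective g.
  by move=> x y /enum_val_inj/(congr1 val)/= /val_inj/enum_rank_inj.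
exists (fun x => tag (g x)) => i.
rewrite -(card_imset _ gI) -[a i]card_ord.
have inj : injective (fun j : 'I_(a i) => Tagged (fun i => 'I_(a i)) j).
  by move=> x y /eqP; rewrite eq_Tagged => /eqP.
rewrite -[X in _ <= X]cardsT -(card_imset _ inj); apply/subset_leq_card/subsetP.
move=> _ /imsetP[x + ->]; rewrite inE; case: (g x) => i' j /= /eqP E.
by subst i'; apply: imset_f.
Qed.

Section LowerBound.
Variables (V : finType) (m : nat) (l : V -> 'I_m).

Definition edge_label x y := if l x <= l y then l y else l x.

Lemma edge_labelC x y : edge_label x y = edge_label y x.
Proof. by rewrite /edge_label; case: ltngtP => // /val_inj. Qed.

Definition label_adj i x y := (x != y) && (edge_label x y == i).

Lemma label_sym i : symmetric (label_adj i).
Proof. by move=> x y; rewrite /label_adj eq_sym edge_labelC. Qed.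

Lemma label_irr i : irreflexive (label_adj i).
Proof. by move=> x; rewrite /label_adj eqxx. Qed.

Definition label_graph i := GraphOn (label_sym i) (label_irr i).

Lemma label_graph_ends i x y :
  label_graph i x y -> [/\ l x <= i, l y <= i & (l x == i) || (l y == i)].
Proof.
rewrite /= /label_adj /edge_label => /andP[_].
by case: leqP => [le|/ltnW le] /eqP <-; rewrite eqxx ?orbT.
Qed.

(** The vertices of label [i] cover the edges of colour [i]. *)
Lemma label_graph_no_matching i n :
  #|[set x | l x == i]| < n -> ~ contains (label_graph i) (matching n).
Proof.
move=> small [f [fI fE]].
pose h (j : 'I_n) := if l (f (j, false)) == i then f (j, false) else f (j, true).
have hI : injective h.
  by move=> j j'; rewrite /h; case: ifP => _; case: ifP => _ /fI [].
move: small; apply/negP; rewrite -leqNgt -[X in X <= _]card_ord -cardsT.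
rewrite -(card_imset _ hI); apply/subset_leq_card/subsetP=> _ /imsetP[j _ ->].
rewrite inE /h; case: ifP => // N.
have /label_graph_ends[_ _] : label_graph i (f (j, false)) (f (j, true)).
  by apply: fE; rewrite /= /matching_adj /= eqxx.
by rewrite N.
Qed.

(** Without isolated vertices, a copy of [G] has each vertex on an edge of
    colour [i], and both ends of such an edge have labels at most [i]. *)
Lemma label_graph_card i (G : graph) :
  (forall x : vertex G, exists y, G x y) ->
  contains (label_graph i) G -> #|vertex G| <= #|[set x | l x <= i]|.
Proof.
move=> noIsolated [f [fI fE]]; rewrite -cardsT -(card_imset _ fI).
apply/subset_leq_card/subsetP=> _ /imsetP[x _ ->]; rewrite inE.
by have [y /fE/label_graph_ends[]] := noIsolated x.
Qed.
End LowerBound.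

Theorem corollary1p3 (t c : nat) (ht : 1 <= t) (hc : 1 <= c) (n : 'I_c -> nat)
  (hpos : forall i : 'I_c, 0 < n i)
  (hmono : forall i j : 'I_c, i <= j -> n j <= n i) :
  is_ramsey_number
    (fcons (star t) (fun i : 'I_c => matching (n i)))
    (maxn t (n (Ordinal hc)) + \sum_(i < c) (n i - 1) + 1).
Proof.
set i0 := Ordinal hc; have n_le i : n i <= n i0 by apply: hmono.
split=> [|H [_ Hcol]|M _ arr]; first by rewrite addn1.
  have col x y : x != y -> exists i, H i x y.
    by move=> /(Hcol x y)[i [Hi _]]; exists i.
  have nk i : n i <= maxn t (n i0) by rewrite leq_max n_le orbT.
  pose N := maxn t (n i0) + \sum_(i < c) (n i - 1) + 1.
  have cardV : N <= #|'I_N| by rewrite card_ord.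
  have [star|[i mat]] := star_or_matching ht (leq_maxl _ _) nk cardV col.
    by exists ord0; rewrite /fcons unlift_none.
  by exists (lift ord0 i); rewrite /fcons liftK.
rewrite leqNgt addn1 ltnS; apply/negP=> leM.
(* when t < n i0, a clique on 2 (n i0) - 1 vertices of label 1 replaces the
   clique on t vertices of label 0 as the core of the colouring *)
pose a (i : 'I_c.+1) := if unlift ord0 i is Some j
  then if (t < n i0) && (j == i0) then (n i0).*2.-1 else (n j).-1
  else if t < n i0 then 0 else t.
have [|l capl] := @capacity_labelling _ 'I_M a.
  rewrite card_ord (leq_trans leM) // big_ord_recl /a unlift_none.
  rewrite (bigD1 i0) //= [X in _ <= _ + X](bigD1 i0) //= liftK eqxx andbT.
  rewrite [X in _ <= _ + (_ + X)](eq_bigr (fun j => n j - 1)); last first.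
    by move=> j /negbTE ne; rewrite liftK ne andbF subn1.
  by have := hpos i0; case: ifP; lia.
have [|i] := arr (label_graph l).
  split=> [i x y /andP[]//|x y xy]; exists (edge_label l x y).
  by split=> [|i /andP[_ /eqP]//]; apply/andP.
have := capl i; rewrite /fcons /a; case: unliftP => [j|] -> {i}.
  case: ifP => [/andP[lt_t /eqP->]|_] cap; last first.
    by apply/label_graph_no_matching/(leq_ltn_trans cap); rewrite ltn_predL.
  move/label_graph_card; rewrite card_prod card_ord card_bool => few.
  have cap0 := capl ord0; rewrite /a unlift_none lt_t in cap0.
  have : n i0 * 2 <= 0 + (n i0).*2.-1.
    apply: leq_trans (leq_add cap0 cap).
    apply: leq_trans (leq_card_setU _ _); apply: leq_trans (few _) _.
      by move=> [k b]; exists (k, ~~ b); rewrite /= /matching_adj eqxx; case: b.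
    apply/subset_leq_card/subsetP=> x; rewrite !inE -!val_eqE /=.
    by case: (val (l x)) => [|[|]].
  by have := hpos i0; clear; lia.
move=> cap /label_graph_card; rewrite card_ord => few.
have : t < #|[set x | l x == ord0]|.
  apply: leq_trans (few _) _ => [x|].
    have [->|nx] := eqVneq x ord0.
      by exists (lift ord0 (Ordinal ht)).
    by exists ord0; rewrite /= /star_adj eqxx (negbTE nx).
  by apply/subset_leq_card/subsetP=> x; rewrite !inE -val_eqE /= leqn0.
by move: cap; case: ifP; lia.
Qed.
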